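(* Let $M\ge 1$, $T>0$, let $t_1<\dots<t_M$ be points of $[-T,T]$, let $c_1,\dots,c_M>0$, let $\mathcal{S}\subset\mathbb{R}$ be a finite set, let $P$ be a positive finite measure on $\mathcal{S}$, and let $\psi:\mathbb{R}^2\to\mathbb{R}$ be a point spread function, differentiable in its second argument. Put $x(s)=\sum_{i=1}^M c_i\psi(s,t_i)$, $w(t)=\int\psi(s,t)\,dP(s)$ and $\mu_\star=\sum_{i=1}^M c_i\delta_{t_i}$. Suppose that $\psi$ satisfies the four conditions INTEGRABILITY, POSITIVITY, INDEPENDENCE and DETERMINANTAL (stated in the context) and that $|\mathcal{S}|>2M$. Then $\mu_\star$ is the unique optimal solution of the optimization problem $$\min_{\mu}\ \int w(t)\,\mu(dt)\quad\text{subject to}\quad x(s)=\int\psi(s,t)\,d\mu(t)\ \ (s\in\mathcal{S}),\quad \operatorname{supp}\mu\subset[-T,T],\quad \mu\ge 0,$$ where $\mu$ ranges over all positive finite measures supported on $[-T,T]$.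
   Context: Here $\delta_t$ is the Dirac measure at $t$, and $\frac{d}{dt_i}\psi(s,t_i)$ denotes the partial derivative of $\psi$ in its second argument evaluated at $(s,t_i)$. $L^2_P$ is the space of functions square-integrable with respect to $P$. Define $$v(s)=\begin{bmatrix}\psi(s,t_1)&\cdots&\psi(s,t_M)&\frac{d}{dt_1}\psi(s,t_1)&\cdots&\frac{d}{dt_M}\psi(s,t_M)\end{bmatrix}^T\in\mathbb{R}^{2M},$$ $$\kappa(t)=\frac{1}{w(t)}\int\psi(s,t)\,v(s)\,dP(s)\in\mathbb{R}^{2M}\quad(\text{for } w(t)\neq 0),$$ $$\Lambda(p_1,\dots,p_{2M+1})=\begin{bmatrix}\kappa(p_1)&\cdots&\kappa(p_{2M+1})\\1&\cdots&1\end{bmatrix}\in\mathbb{R}^{(2M+1)\times(2M+1)}.$$ The four conditions on $\psi$ are: INTEGRABILITY: $\psi(\cdot,t)\in L^2_P$ for every $t$. POSITIVITY: $w(t)>0$ for all $t\in[-T,T]$. INDEPENDENCE: the matrix $\int v(s)v(s)^T\,dP(s)$ is nonsingular. DETERMINANTAL: there exists $\rho>0$ such that for any $t_i^-,t_i^+\in(t_i-\rho,t_i+\rho)$ ($i=1,\dots,M$) and any $t\in[-T,T]$, the matrix $\Lambda(t_1^-,t_1^+,\dots,t_M^-,t_M^+,t)$ is (defined and) nonsingular whenever $t,t_1^-,t_1^+,\dots,t_M^-,t_M^+$ are distinct. *)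

(* Defs.v *)
From HB Require Import structures.
From mathcomp Require Import all_boot all_order all_algebra finmap.
From mathcomp Require Import all_classical all_reals all_analysis.

Set Implicit Arguments.
Unset Strict Implicit.
Unset Printing Implicit Defensive.

Import Order.TTheory GRing.Theory Num.Theory numFieldNormedType.Exports.

Local Open Scope classical_set_scope.
Local Open Scope ring_scope.

Notation finmeas R := {finite_measure set (measurableTypeR R) -> \bar R}.

Section model.
Context {R : realType} (M : nat) (t : 'I_M -> R) (c : 'I_M -> {posnum R}).

Definition signal (psi : R -> R -> R) (s : R) : R :=
  \sum_(i < M) (c i)%:num * psi s (t i).

Definition mu_star (A : set (measurableTypeR R)) : \bar R :=
  (\sum_(i < M) ((c i)%:num)%:E * \d_(t i) A)%E.

Let mu_star0 : mu_star set0 = 0%E.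
Proof. by rewrite /mu_star big1// => i _; rewrite measure0 mule0. Qed.

Let mu_star_ge0 A : (0 <= mu_star A)%E.
Proof. by apply: sume_ge0 => i _; rewrite mule_ge0// lee_fin. Qed.

Let mu_star_sigma_additive : semi_sigma_additive mu_star.
Proof.
move=> F mF tF mUF; rewrite [X in _ --> X](_ : _ =
    limn (fun n => \sum_(0 <= i < n) mu_star (F i))%E).
  by apply: is_cvg_nneseries => k _ _; exact: mu_star_ge0.
rewrite nneseries_sum//; last first.
  by move=> i j _; rewrite mule_ge0// lee_fin.
apply: eq_bigr => i _; rewrite nneseriesZl//.
by congr (_ * _)%E; exact: measure_semi_bigcup.
Qed.

HB.instance Definition _ := isMeasure.Build _ _ _ mu_star
  mu_star0 mu_star_ge0 mu_star_sigma_additive.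

Let mu_star_finite : fin_num_fun mu_star.
Proof. by move=> A mA; apply/sum_fin_numP => i _ _; rewrite fin_numM. Qed.

HB.instance Definition _ := Measure_isFinite.Build _ _ _ mu_star mu_star_finite.

End model.

Section conditions.
Context {R : realType}.
(* No measurability of psi in its first argument is assumed, so integrals
   against P are always taken over the finite set S carrying P. *)
Context (S : {fset R}) (P : finmeas R) (psi : R -> R -> R) (T : R).

Definition carried_by : Prop := P (~` [set` S]) = 0%E.

Definition weight (u : R) : R := \int[P]_(s in [set` S]) psi s u.

Section matrices.
Context (M : nat) (t : 'I_M -> R).

Definition vvec (s : R) : 'cV[R]_(M + M) :=
  col_mx (\col_i psi s (t i)) (\col_i derive1 (psi s) (t i)).

Definition kappa (u : R) : 'cV[R]_(M + M) :=
  (weight u)^-1 *: \col_k \int[P]_(s in [set` S]) (psi s u * vvec s k 0).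

Definition gram : 'M[R]_(M + M) :=
  \matrix_(k, l) \int[P]_(s in [set` S]) (vvec s *m (vvec s)^T) k l.

Definition Lambda (p : seq R) : 'M[R]_(M + M + 1) :=
  col_mx (\matrix_(k < M + M, j < M + M + 1) kappa p`_j k 0) (const_mx 1).

(* The 2M+1 nodes t_1^-, t_1^+, ..., t_M^-, t_M^+, u, in this order. *)
Definition nodes (tm tp : 'I_M -> R) (u : R) : seq R :=
  rcons (flatten [seq [:: tm i; tp i] | i <- enum 'I_M]) u.

Definition independence : Prop := gram \in unitmx.

(* kappa is meaningful only where weight is nonzero, so that condition on the
   nodes is part of the conclusion. *)
Definition determinantal : Prop :=
  exists2 rho : R, 0 < rho &
    forall (tm tp : 'I_M -> R) (u : R),
      (forall i, tm i \in `]t i - rho, t i + rho[) ->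
      (forall i, tp i \in `]t i - rho, t i + rho[) ->
      u \in `[- T, T] ->
      uniq (nodes tm tp u) ->
      (forall p, p \in nodes tm tp u -> weight p != 0) /\
      Lambda (nodes tm tp u) \in unitmx.

End matrices.

Definition integrability : Prop :=
  forall u, psi^~ u \_ [set` S] \in Lfun P 2%:E.

Definition positivity : Prop := forall u, u \in `[- T, T] -> 0 < weight u.

End conditions.

Section program.
Context {R : realType}.

Definition msupp (mu : finmeas R) : set R :=
  [set u | forall U : set R, open U -> U u -> (0 < mu U)%E].

Context (S : {fset R}) (P : finmeas R) (psi : R -> R -> R) (T : R).
Context (x : R -> R).

Definition feasible (mu : finmeas R) : Prop :=
  msupp mu `<=` `[- T, T] /\
  forall s, s \in S -> (\int[mu]_u (psi s u)%:E = (x s)%:E)%E.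

Definition objective (mu : finmeas R) : \bar R :=
  (\int[mu]_u (weight S P psi u)%:E)%E.

Definition optimal (mu : finmeas R) : Prop :=
  feasible mu /\ forall nu, feasible nu -> (objective mu <= objective nu)%E.

End program.

(* Main.v *)
Require Import Defs.
From HB Require Import structures.
From mathcomp Require Import all_boot all_order all_algebra finmap.
From mathcomp Require Import all_classical all_reals all_analysis.
From mathcomp Require Import measurable_realfun ring lra.

Import Order.TTheory GRing.Theory Num.Theory numFieldNormedType.Exports.
Local Open Scope classical_set_scope.
Local Open Scope ring_scope.

Set Implicit Arguments.
Unset Strict Implicit.
Unset Printing Implicit Defensive.

(** The constraints leave [mu_star] as the only feasible measure, so that it is
    optimal for want of a competitor.

    Write [w] for [weight] and let [F] range over the span of [w] and of the
    [2M] functions [u |-> \int psi(s, u) v_k(s) dP(s)].  Since [P] is only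
    integrated over the finite set [S], every such [F] is a linear combination
    of the functions [psi s], [s \in S]; hence the constraints fix its integral
    and [\int F dmu = \sum_i c_i F(t_i)] for every feasible [mu]
    ([integral_comb_feasible]).  If some [F] vanishes at all the [t_i] and is
    positive on the rest of [[-T, T]], then [\int F dmu = 0], so [mu] lives on
    the nodes ([null_setC_zeros]); testing [mu] with an [F] that is [1] at one
    node and [0] at the others then gives the masses ([delta_comb]).

    The function [F] comes from the determinantal condition, which says that
    values of [F] can be prescribed uniquely at [2M+1] points: two straddling
    each [t_i] and one more, anywhere in a neighbourhood of [[-T, T]]
    ([determinantal_chebyshev]).  In particular a nonzero [F] never vanishes at
    [2M+1] such points.  This is exploited three times.

    - Take [F] with zeros at the [t_i] and the [t_i + e].  If [F] kept its sign
      at one of these zeros, a small multiple of an interpolant would push that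
      zero apart into two, giving [2M+1] zeros ([simple_zeros]).  So [F] changes
      sign at each of these points and only there; it has the same sign on both
      sides of every pair [t_i], [t_i + e] ([nonneg_off_splits]).
    - Normalise the coefficients and let [e] tend to [0]: a cluster point is a
      nonzero [F >= 0] that vanishes at every [t_i] ([double_zero_comb]).
    - If this [F] had a further zero [x] in [[-T, T]], adding a small multiple of
      a function that is zero at [x] and negative at those [t_i] that are
      isolated zeros would split each of these into two zeros, again [2M+1] in
      all ([positive_off_nodes]). *)

(** * Zeros and signs of continuous functions *)

Lemma sign_change_root (R : realType) (f : R -> R) (a b : R) :
  continuous f -> a < b -> f a * f b < 0 ->
  exists2 z, a < z < b & f z = 0.
Proof.
move=> cf ab fafb.
have [z zab fz0] : exists2 z, z \in `[a, b] & f z = 0.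
  apply: IVT (ltW ab) (continuous_subspaceT cf) _.
  move: fafb; have [fab|fab] := leP (f a) (f b) => fafb; apply/andP; split; nra.
exists z => //; move: zab; rewrite in_itv/= !le_eqVlt.
have az : (a == z) = false.
  by apply/eqP => az; move: fafb; rewrite az fz0 mul0r ltxx.
have zb : (z == b) = false.
  by apply/eqP => zb; move: fafb; rewrite -zb fz0 mulr0 ltxx.
by rewrite az zb.
Qed.

Lemma continuousDM (R : realType) (f g : R -> R) (d : R) :
  continuous f -> continuous g -> continuous (fun u => f u + d * g u).
Proof.
move=> cf cg u; apply: (@continuousD R R R f (fun u => d * g u) u (cf u)).
by apply: (@continuousM R R (cst d) g u _ (cg u)); exact: cvg_cst.
Qed.

Lemma near0_pos_add (R : realType) (x y : R) : 0 < x ->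
  \forall d \near 0^'+, 0 < x + d * y.
Proof.
move=> x0; near=> d.
have d0 : 0 < d by near: d; exact: nbhs_right_gt.
have y1 : 0 < `|y| + 1 by have := normr_ge0 y; lra.
have : d < x / (`|y| + 1) by near: d; apply: nbhs_right_lt; rewrite divr_gt0.
rewrite ltr_pdivlMr// => dx.
have yy : 0 <= `|y| + y by have := ler_norm (- y); rewrite normrN; lra.
by have : 0 <= d * (`|y| + y) by [rewrite mulr_ge0// ltW]; lra.
Unshelve. all: by end_near. Qed.

(** A zero at which [f] keeps its sign is unstable: it splits into two zeros
    under any perturbation of the opposite sign.  Asking for all small [d],
    rather than for one, allows several zeros to be split simultaneously. *)
Lemma perturb_roots (R : realType) (f g : R -> R) (a p b : R) :
  continuous f -> continuous g -> a < p -> p < b ->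
  f p = 0 -> 0 < f a -> 0 < f b -> g p < 0 ->
  \forall d \near 0^'+, exists z1 z2,
    [/\ a < z1 < p, p < z2 < b, f z1 + d * g z1 = 0 & f z2 + d * g z2 = 0].
Proof.
move=> cf cg ap pb fp0 fa0 fb0 gp0.
have da := near0_pos_add (g a) fa0; have db := near0_pos_add (g b) fb0.
near=> d; have d0 : 0 < d by near: d; exact: nbhs_right_gt.
have ha0 : 0 < f a + d * g a by near: d.
have hb0 : 0 < f b + d * g b by near: d.
pose h u := f u + d * g u.
have ch : continuous h := continuousDM cf cg.
have hp0 : h p < 0 by rewrite /h fp0 add0r pmulr_rlt0.
have [z1 z1ap hz1] : exists2 z, a < z < p & h z = 0.
  by apply: sign_change_root => //; rewrite pmulr_rlt0.
have [z2 z2pb hz2] : exists2 z, p < z < b & h z = 0.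
  by apply: sign_change_root => //; rewrite nmulr_rlt0.
by exists z1, z2.
Unshelve. all: by end_near. Qed.

Definition nodal_poly {R : realType} (Z : seq R) (u : R) : R :=
  \prod_(z <- Z) (u - z).

Lemma nodal_sign_change (R : realType) (Z : seq R) (a p b : R) :
  uniq Z -> p \in Z -> a < p < b ->
  (forall z, z \in Z -> a <= z <= b -> z = p) ->
  nodal_poly Z a * nodal_poly Z b < 0.
Proof.
move=> uZ pZ /andP[ap pb] Zp; rewrite /nodal_poly -big_split/= (bigD1_seq p)//=.
rewrite nmulr_rlt0; last by nra.
rewrite big_seq_cond; apply: prodr_gt0 => z /andP[zZ zp].
have : ~~ (a <= z <= b) by apply: contra zp => zab; rewrite (Zp z).
by rewrite negb_and -!ltNge => /orP[] ?; nra.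
Qed.

Lemma nodal_same_sign (R : realType) (Z : seq R) (a b : R) :
  a <= b -> (forall z, z \in Z -> ~~ (a <= z <= b)) ->
  0 < nodal_poly Z a * nodal_poly Z b.
Proof.
move=> ab Zab; rewrite /nodal_poly -big_split/= big_seq; apply: prodr_gt0 => z /Zab.
by rewrite negb_and -!ltNge => /orP[] ?; nra.
Qed.

Lemma isolated_near (R : realType) (Z : seq R) (p : R) :
  \forall e \near 0^'+, forall z, z \in Z -> p - e <= z <= p + e -> z = p.
Proof.
elim: Z => [|x Z IH]; first by near=> e => z; rewrite in_nil.
have [->|xp] := eqVneq x p.
  by apply: filterS IH => e IH z; rewrite inE => /orP[/eqP ->//|/IH].
near=> e => z; rewrite inE => /orP[/eqP ->|]; last first.
  by move: z; near: e.
have : e < `|x - p| by near: e; apply: nbhs_right_lt; rewrite normr_gt0 subr_eq0.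
by rewrite ltr_normr => /orP[] ? /andP[]; lra.
Unshelve. all: by end_near. Qed.

(** If [f] changes sign at each of its zeros, its sign is that of the monic
    polynomial with the same zeros, up to a global constant: the product of the
    two functions changes sign nowhere.  The proof is by induction on the number
    of zeros separating [a] and [b]. *)
Lemma sign_pattern (R : realType) (f : R -> R) (Z : seq R) (D : set R) :
  continuous f -> uniq Z -> is_interval D ->
  (forall u, D u -> f u = 0 -> u \in Z) ->
  (forall p, p \in Z -> \forall e \near 0^'+, f (p - e) * f (p + e) < 0) ->
  forall a b, D a -> D b -> a \notin Z -> b \notin Z ->
    0 < f a * nodal_poly Z a * (f b * nodal_poly Z b).
Proof.
move=> cf uZ itvD fZ fchange.
suff main k a b : (count (fun z => (a < z < b)%R) Z <= k)%N ->
    D a -> D b -> a \notin Z -> b \notin Z -> a <= b ->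
    0 < f a * nodal_poly Z a * (f b * nodal_poly Z b).
  move=> a b Da Db aZ bZ; have [ab|ba] := leP a b; first exact: main (leqnn _) _ _ _ _ _.
  by rewrite mulrC; apply: main (leqnn _) _ _ _ _ _ => //; exact: ltW.
elim: k a b => [|k IH] a b.
  rewrite leqn0 -leqn0 leqNgt -has_count => /hasPn noZ Da Db aZ bZ ab.
  have nZ z : z \in Z -> ~~ (a <= z <= b).
    move=> zZ; have := noZ _ zZ; apply: contra => /andP[az zb].
    by rewrite !lt_neqAle az zb !andbT; apply/andP; split;
      [apply: contra aZ => /eqP->|apply: contra bZ => /eqP<-].
  rewrite mulrACA; apply: mulr_gt0; last exact: nodal_same_sign.
  rewrite ltNge le_eqVlt; apply/negP => /orP[|fab].
    rewrite mulf_eq0 => /orP[/eqP/(fZ _ Da)|/eqP/(fZ _ Db)];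
      by [rewrite (negbTE aZ)|rewrite (negbTE bZ)].
  move: ab; rewrite le_eqVlt => /orP[/eqP ab|ab].
    by move: fab; rewrite ab -expr2 ltNge sqr_ge0.
  have [z /andP[az zb] fz] := sign_change_root cf ab fab.
  have Dz : D z by apply: (itvD _ _ Da Db); rewrite !ltW.
  by have := nZ _ (fZ _ Dz fz); rewrite !ltW.
rewrite leq_eqVlt => /orP[/eqP cnt|]; last by rewrite ltnS; exact: IH.
move=> Da Db aZ bZ ab.
have /hasP[p pZ /andP[ap pb]] : has (fun z => (a < z < b)%R) Z by rewrite has_count cnt.
have fewer (x y : R) : a <= x -> y <= b -> ~~ (x < p < y) ->
    (count (fun z => (x < z < y)%R) Z <= k)%N.
  move=> ax yb xpy; rewrite -[k]/(k.+1.-1) -cnt.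
  have -> : count (fun z => (x < z < y)%R) Z = count (fun z => (x < z < y)%R) (rem p Z).
    by rewrite count_rem pZ (negbTE xpy) subn0.
  have -> : (count (fun z => (a < z < b)%R) Z).-1 = count (fun z => (a < z < b)%R) (rem p Z).
    by rewrite count_rem pZ ap pb subn1.
  by apply: sub_count => z /andP[xz zy]; rewrite (le_lt_trans ax)//= (lt_le_trans zy).
clear cnt.
have : \forall e \near 0^'+, [/\ f (p - e) * f (p + e) < 0, a < p - e, p + e < b,
    0 < e & forall z, z \in Z -> p - e <= z <= p + e -> z = p].
  near=> e; split.
  - by near: e; exact: fchange.
  - have : e < p - a by near: e; apply: nbhs_right_lt; rewrite subr_gt0.
    by rewrite ltrBrDr -ltrBrDl.
  - by rewrite -ltrBrDl; near: e; apply: nbhs_right_lt; rewrite subr_gt0.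
  - by near: e; exact: nbhs_right_gt.
  - by near: e; exact: isolated_near.
move=> /filter_ex[e [fe ae eb e0 eZ]].
have pZ' x : x \in [:: p - e; p + e] -> x \notin Z.
  rewrite !inE => xe; apply/negP => xZ.
  suff : x = p by case/orP: xe => /eqP -> ?; lra.
  by apply: eZ => //; case/orP: xe => /eqP ->; apply/andP; split; lra.
have Dl : D (p - e) by apply: (itvD _ _ Da Db); apply/andP; split; lra.
have Dr : D (p + e) by apply: (itvD _ _ Da Db); apply/andP; split; lra.
(* Cross [p] from [p - e] to [p + e]; fewer zeros remain on either side. *)
have l : 0 < f a * nodal_poly Z a * (f (p - e) * nodal_poly Z (p - e)).
  apply: IH => //; [|by apply: pZ'; rewrite !inE eqxx|exact: ltW].
  apply: fewer; [by []|lra|by rewrite negb_and -!leNgt; apply/orP; right; lra].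
have m : 0 < f (p - e) * nodal_poly Z (p - e) * (f (p + e) * nodal_poly Z (p + e)).
  rewrite mulrACA nmulr_rgt0//; apply: (@nodal_sign_change _ _ _ p) => //.
  by apply/andP; split; lra.
have r : 0 < f (p + e) * nodal_poly Z (p + e) * (f b * nodal_poly Z b).
  apply: IH => //; [|by apply: pZ'; rewrite !inE eqxx orbT|exact: ltW].
  apply: fewer; [lra|by []|by rewrite negb_and -!leNgt; apply/orP; left; lra].
move: l m r; set A := f a * _; set B := f b * _.
set L := f (p - e) * _; set Q := f (p + e) * _.
move=> AL LQ QB.
rewrite -(pmulr_lgt0 _ (mulr_gt0 LQ LQ)).
have -> : A * B * (L * Q * (L * Q)) = A * L * (Q * B) * (L * Q) by ring.
by apply: mulr_gt0 => //; apply: mulr_gt0.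
Unshelve. all: by end_near. Qed.

(** * A nonnegative combination with double zeros *)

Section chebyshev_system.
Context {R : realType} {n M : nat}.
Context (phi : R -> 'cV[R]_n) (t : 'I_M -> R) (T : R).

Definition comb (g : 'rV[R]_n) (u : R) : R := (g *m phi u) 0 0.

(** A neighbourhood of [[-T, T]] only near the nodes: a node at an end of the
    interval needs room on both of its sides, while nothing is known about the
    combinations elsewhere outside the interval. *)
Definition reach (r : R) : set R :=
  [set u | - T <= u <= T \/ exists i, `|u - t i| < r].

(** Weak inequalities let a node itself be one of its two companions.  Keeping
    the node between them ensures, when [r <= T], that at least one of the two
    lies in [[-T, T]]. *)
Definition straddle (r : R) (p q : 'I_M -> R) : Prop := forall i,
  [/\ t i - r < p i, p i <= t i, t i <= q i, q i < t i + r & p i < q i].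

Definition node_set (p q : 'I_M -> R) (u : R) : set R :=
  [set v | v = u \/ exists i, v = p i \/ v = q i].

Definition unisolvent (N : set R) : Prop :=
  (forall g, (forall v, N v -> comb g v = 0) -> g = 0) /\
  (forall y : R -> R, exists g, forall v, N v -> comb g v = y v).

(** The Haar condition, restricted to configurations with two points at every
    node and one free point. *)
Definition chebyshev_near (r : R) : Prop := forall p q u,
  straddle r p q -> reach r u -> (forall i, u != p i /\ u != q i) ->
  unisolvent (node_set p q u).

Definition spaced (r : R) : Prop :=
  forall i j, i != j -> 2 * r <= `|t i - t j|.

Lemma combDZ g d h u : comb (g + d *: h) u = comb g u + d * comb h u.
Proof. by rewrite /comb mulmxDl -scalemxAl !mxE. Qed.

Lemma combZ d h u : comb (d *: h) u = d * comb h u.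
Proof. by rewrite /comb -scalemxAl mxE. Qed.

Lemma comb0 u : comb 0 u = 0.
Proof. by rewrite /comb mul0mx mxE. Qed.

Implicit Types (r e : R) (i j : 'I_M).

Lemma reach_interval r :
  (forall i, - T <= t i <= T) -> is_interval (reach r).
Proof.
move=> tT x y rx ry z /andP[xz zy].
have [Tz|zT] := leP (- T) z; last first.
  case: rx => [/andP[? ?]|[i xi]]; first lra.
  right; exists i; have /andP[? ?] := tT i.
  by move: xi; rewrite !ltr_norml => /andP[? ?]; apply/andP; split; lra.
have [{}zT|{}Tz] := leP z T; first by left; rewrite Tz.
case: ry => [/andP[? ?]|[i yi]]; first lra.
right; exists i; have /andP[? ?] := tT i.
by move: yi; rewrite !ltr_norml => /andP[? ?]; apply/andP; split; lra.
Qed.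

Lemma spacedP r i j : spaced r -> i != j ->
  t i + 2 * r <= t j \/ t j + 2 * r <= t i.
Proof.
by move=> sep /sep; rewrite ler_normr => /orP[?|?]; [right|left]; lra.
Qed.

Lemma spaced_inj r : 0 < r -> spaced r -> injective t.
Proof.
move=> r0 sep i j tij; apply/eqP/negPn/negP => /(spacedP sep).
by rewrite tij => -[] ?; lra.
Qed.

Lemma reach_near r u i : t i - r < u < t i + r -> reach r u.
Proof.
move=> /andP[? ?]; right; exists i; rewrite ltr_norml.
by apply/andP; split; lra.
Qed.

(** Each node [t i] is regarded as the limit of the pair of simple zeros
    [t i], [t i + e]. *)
Definition split_nodes e : seq R := codom t ++ codom (fun i => t i + e).

Lemma split_nodesP e u :
  reflect (exists i, u = t i \/ u = t i + e) (u \in split_nodes e).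
Proof.
apply: (iffP idP) => [|[i [->|->]]]; rewrite mem_cat.
- by case/orP => /codomP[i ->]; exists i; [left|right].
- by rewrite codom_f.
- by rewrite (codom_f (fun i => t i + e)) orbT.
Qed.

Lemma straddle_split r e : 0 < e -> e < r -> straddle r t (fun i => t i + e).
Proof. by move=> e0 er i; split; lra. Qed.

Lemma split_nodes_uniq r e : 0 < e -> e < r -> spaced r -> uniq (split_nodes e).
Proof.
move=> e0 er sep; have r0 : 0 < r by lra.
rewrite cat_uniq; apply/and3P; split.
- exact/injectiveP/(spaced_inj r0).
- apply/hasPn => _ /codomP[i ->]; apply/negP => /codomP[j] /= tij.
  have [ij|/(spacedP sep) []] := eqVneq i j; [|lra|lra].
  by move: tij; rewrite ij; lra.
- by apply/injectiveP => i j /addIr /(spaced_inj r0 sep).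
Qed.

Lemma not_split_nodes e u : u \notin split_nodes e ->
  forall i, u != t i /\ u != t i + e.
Proof.
move=> uZ i; split; apply: contra uZ => /eqP ->; apply/split_nodesP; exists i;
  by [left|right].
Qed.

Lemma midpoint_not_split r e i : 0 < e -> e < r -> spaced r ->
  t i + e / 2 \notin split_nodes e.
Proof.
move=> e0 er sep; apply/negP => /split_nodesP[j].
by have [<-|/(spacedP sep)[] ?] := eqVneq i j; move=> [] ?; lra.
Qed.

(** Splitting one of the [2M] points [p] of [split_nodes e] into [z1] and [z2]
    yields an admissible configuration of [2M+1] points.  When [p = t i], the
    points [z1], [z2] straddle [t i] and [t i + e] is the free point; when
    [p = t i + e], the pair is [t i], [z1] and the free point is [z2]. *)
Lemma split_node_zeros r e d p z1 z2 w : 0 < e -> spaced r -> chebyshev_near r ->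
  p \in split_nodes e -> d < e -> d + e < r ->
  p - d < z1 < p -> p < z2 < p + d ->
  (forall u, u \in split_nodes e -> u != p -> comb w u = 0) ->
  comb w z1 = 0 -> comb w z2 = 0 -> w = 0.
Proof.
move=> e0 sep cheb pZ de der z1p z2p wZ wz1 wz2.
have d0 : 0 < d by move: z1p => /andP[? ?]; lra.
have er : e < r by lra.
have r0 : 0 < r by lra.
have far := spacedP sep; have tinj := spaced_inj r0 sep.
have strad_t := straddle_split e0 er.
have memZ u : reflect (exists i, u = t i \/ u = t i + e) (u \in split_nodes e).
  exact: split_nodesP.
have [i pE] := memZ _ pZ.
have [p' [q' [u [strad ru distinct wN]]]] : exists p' q' u, [/\ straddle r p' q', reach r u,
    forall j, u != p' j /\ u != q' j & forall v, node_set p' q' u v -> comb w v = 0].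
  case: pE => pE; move: z1p z2p; rewrite pE => /andP[? ?] /andP[? ?].
  - exists (fun j => if j == i then z1 else t j),
      (fun j => if j == i then z2 else t j + e), (t i + e).
    split.
    + move=> j; case: eqP => [->|_]; last exact: strad_t.
      by split; lra.
    + by apply: (@reach_near _ _ i); apply/andP; split; lra.
    + move=> j; have [ji|/far ij] := eqVneq j i; first by split; apply/eqP; lra.
      by split; apply/eqP; case: ij => ?; lra.
    + move=> v [->|[j]].
        by apply: wZ; [apply/memZ; exists i; right|rewrite pE; apply/eqP; lra].
      have [_ [->|->]//|ji] := eqVneq j i.
      case=> ->; apply: wZ; rewrite ?pE.
      * by apply/memZ; exists j; left.
      * by apply: contra_neq ji => /tinj.
      * by apply/memZ; exists j; right.
      * by apply/eqP; case: (far _ _ ji) => ?; lra.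
  - exists t, (fun j => if j == i then z1 else t j + e), z2.
    split.
    + move=> j; case: eqP => [->|_]; last exact: strad_t.
      by split; lra.
    + by apply: (@reach_near _ _ i); apply/andP; split; lra.
    + move=> j; have [->|/far ij] := eqVneq j i; first by split; apply/eqP; lra.
      by split; apply/eqP; case: ij => ?; lra.
    + move=> v [->//|[j]]; case => [->|].
        apply: wZ; first by apply/memZ; exists j; left.
        rewrite pE; apply/eqP; have [->|/far[] ?] := eqVneq j i; lra.
      have [_ ->//|ji ->] := eqVneq j i.
      apply: wZ; first by apply/memZ; exists j; right.
      by rewrite pE; apply: contra_neq ji => /addIr /tinj.
by have [/(_ w wN)] := cheb _ _ _ strad ru distinct.
Qed.

(** Zeros at all of [split_nodes e] use up all the zeros that a combination may
    have, so none of them is double: one at which the sign is kept could be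
    split in two by [perturb_roots], against [split_node_zeros]. *)
Lemma simple_zeros r e g : 0 < e -> e < r -> spaced r -> chebyshev_near r ->
  (forall h, continuous (comb h)) ->
  (forall u, u \in split_nodes e -> comb g u = 0) ->
  (forall u, reach r u -> comb g u = 0 -> u \in split_nodes e) ->
  forall p, p \in split_nodes e ->
    \forall d \near 0^'+, comb g (p - d) * comb g (p + d) < 0.
Proof.
move=> e0 er sep cheb comb_continuous gZ Zg p pZ.
have memZ u : reflect (exists i, u = t i \/ u = t i + e) (u \in split_nodes e).
  exact: split_nodesP.
have strad_t := straddle_split e0 er.
have [i pE] := memZ _ pZ.
near=> d.
have d0 : 0 < d by near: d; exact: nbhs_right_gt.
have de : d < e by near: d; exact: nbhs_right_lt.
have der : d + e < r.
  have : d < r - e by near: d; apply: nbhs_right_lt; rewrite subr_gt0.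
  lra.
have iso : forall z, z \in split_nodes e -> p - d <= z <= p + d -> z = p.
  by near: d; exact: isolated_near.
have nz x : p - d <= x <= p + d -> x != p -> comb g x != 0.
  move=> xd; apply: contraNneq => gx.
  have rx : reach r x.
    apply: (@reach_near _ _ i); move: xd pE => /andP[xl xr] pE.
    by case: pE => pE; rewrite pE in xl xr; apply/andP; split; lra.
  by rewrite (iso x)//; apply: Zg.
have nza : comb g (p - d) != 0 by apply: nz; [apply/andP; split; lra|apply/eqP; lra].
have nzb : comb g (p + d) != 0 by apply: nz; [apply/andP; split; lra|apply/eqP; lra].
rewrite ltNge le_eqVlt; apply/negP => /orP[|same].
  by rewrite eq_sym mulf_eq0 (negbTE nza) (negbTE nzb).
(* Scaling by [comb g (p - d)] makes both neighbouring values positive. *)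
have [k [kZ ka kb]] : exists k, [/\ forall u, u \in split_nodes e -> comb k u = 0,
    0 < comb k (p - d) & 0 < comb k (p + d)].
  exists (comb g (p - d) *: g); split.
  - by move=> u uZ; rewrite combZ (gZ u) ?mulr0.
  - by rewrite combZ -expr2 exprn_even_gt0.
  - by rewrite combZ.
(* An arbitrary free point, which completes [split_nodes e] to a set where
   values can be prescribed. *)
pose u0 := t i + e / 2.
have u0Z : u0 \notin split_nodes e by exact: midpoint_not_split sep.
have ru0 : reach r u0.
  by apply: (@reach_near _ _ i); rewrite /u0; apply/andP; split; lra.
have [_ /(_ (fun v => if v == p then -1 else 0))[h hy]] :=
  cheb _ _ _ strad_t ru0 (not_split_nodes u0Z).
have hp : comb h p = -1.
  by rewrite hy ?eqxx//; right; have [j ?] := memZ _ pZ; exists j.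
have hZ u : u \in split_nodes e -> u != p -> comb h u = 0.
  by move=> /memZ[j uj] up; rewrite hy ?(negbTE up)//; right; exists j.
have /filter_ex[s [s0 [z1 [z2 [z1p z2p hz1 hz2]]]]] : \forall s \near 0^'+, 0 < s /\
    exists z1 z2, [/\ p - d < z1 < p, p < z2 < p + d,
      comb k z1 + s * comb h z1 = 0 & comb k z2 + s * comb h z2 = 0].
  near=> s; split; first by near: s; exact: nbhs_right_gt.
  near: s; apply: (@perturb_roots R (comb k) (comb h)) => //; [lra|lra|exact: kZ|].
  by rewrite hp ltrN10.
pose w := k + s *: h.
have wp : comb w p = - s by rewrite combDZ kZ// hp; lra.
have wZ u : u \in split_nodes e -> u != p -> comb w u = 0.
  by move=> uZ up; rewrite combDZ kZ// hZ// mulr0 addr0.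
have wz1 : comb w z1 = 0 by rewrite combDZ.
have wz2 : comb w z2 = 0 by rewrite combDZ.
have w0 : w = 0 := split_node_zeros e0 sep cheb pZ de der z1p z2p wZ wz1 wz2.
by move: wp; rewrite w0 comb0; lra.
Unshelve. all: by end_near. Qed.

(** The combination that vanishes on [split_nodes e] has the sign of the product
    of the [(u - t i) * (u - t i - e)], by [sign_pattern]; this product is
    positive as soon as [u] is in none of the segments [[t i, t i + e]]. *)
Lemma nonneg_off_splits r e (i0 : 'I_M) : 0 < e -> e < r ->
  (forall i, - T <= t i <= T) -> spaced r -> chebyshev_near r ->
  (forall h, continuous (comb h)) ->
  exists g, [/\ `|g| = 1, forall i, comb g (t i) = 0 &
    forall u, reach r u -> (forall i, ~~ (t i <= u <= t i + e)) ->
    0 <= comb g u].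
Proof.
move=> e0 er tT sep cheb comb_continuous.
have strad_t := straddle_split e0 er.
pose u0 := t i0 + e / 2.
have u0Z : u0 \notin split_nodes e by exact: midpoint_not_split sep.
have ru0 : reach r u0.
  by apply: (@reach_near _ _ i0); rewrite /u0; apply/andP; split; lra.
have [_ /(_ (fun v => if v == u0 then 1 else 0))[g gy]] :=
  cheb _ _ _ strad_t ru0 (not_split_nodes u0Z).
have gu0 : comb g u0 = 1 by rewrite gy ?eqxx//; left.
have gZ u : u \in split_nodes e -> comb g u = 0.
  move=> uZ; rewrite gy; last by right; exact/split_nodesP.
  by case: eqP => // uu0; move: u0Z; rewrite -uu0 uZ.
have Zg u : reach r u -> comb g u = 0 -> u \in split_nodes e.
  move=> ru gu; apply/negPn/negP => uZ.
  have [/(_ g) g0 _] := cheb _ _ _ strad_t ru (not_split_nodes uZ).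
  move: gu0; rewrite g0 ?comb0 => [/eqP|v [->//|/split_nodesP/gZ//]].
  by rewrite eq_sym oner_eq0.
have pat := sign_pattern (comb_continuous g) (split_nodes_uniq e0 er sep)
  (reach_interval tT) Zg (simple_zeros e0 er sep cheb comb_continuous gZ Zg).
set N := nodal_poly _ in pat.
pose k := (comb g u0 * N u0) *: g.
have kpos u : reach r u -> (forall i, ~~ (t i <= u <= t i + e)) -> 0 < comb k u.
  move=> ru uoff.
  have uZ : u \notin split_nodes e.
    apply/negP => /split_nodesP[i] ui; have := uoff i.
    by rewrite negb_and -!ltNge; case: ui => -> /orP[]; lra.
  have Nu : 0 < N u.
    rewrite /N /nodal_poly /split_nodes big_cat/= !big_map -big_split/=.
    apply: prodr_gt0 => i _; have := uoff i.
    by rewrite negb_and -!ltNge => /orP[] ?; nra.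
  have := pat _ _ ru0 ru u0Z uZ.
  by rewrite combZ mulrA pmulr_lgt0.
have k0 : k != 0.
  apply/eqP => k0; have := pat _ _ ru0 ru0 u0Z u0Z.
  by rewrite mulrA -combZ -/k k0 comb0 mul0r ltxx.
exists (`|k|^-1 *: k); split.
- by rewrite normrZ normfV normr_id mulVf// normr_eq0.
- move=> i; rewrite !combZ (gZ (t i)) ?mulr0//.
  by apply/split_nodesP; exists i; left.
- by move=> u ru uoff; rewrite combZ mulr_ge0// ltW// kpos.
Qed.

Lemma comb_continuousl u : continuous (comb ^~ u).
Proof.
rewrite (_ : comb ^~ u = fun g => \sum_(k < n) g 0 k * phi u k 0).
  apply: continuous_big; first exact: add_continuous.
  move=> k _ g.
  apply: (@continuousM R _ (fun h : 'rV[R]_n => h 0 k) (cst (phi u k 0))).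
    exact: coord_continuous.
  exact: cst_continuous.
by apply/funext => g; rewrite /comb mxE.
Qed.

(** Unit coefficient vectors form a compact set, and each of the conditions
    [comb g (t i) = 0] and [0 <= comb g u] is closed in [g], so that the
    combinations of [nonneg_off_splits] have a suitable cluster point as [e]
    tends to [0]. *)
Lemma double_zero_comb r (i0 : 'I_M) : 0 < r ->
  (forall i, - T <= t i <= T) -> spaced r -> chebyshev_near r ->
  (forall h, continuous (comb h)) ->
  exists g, [/\ g != 0, forall i, comb g (t i) = 0 &
    forall u, reach r u -> 0 <= comb g u].
Proof.
move=> r0 tT sep cheb comb_continuous.
have /choice[G GP] : forall e, exists g, 0 < e < r -> [/\ `|g| = 1,
    forall i, comb g (t i) = 0 & forall u, reach r u ->
    (forall i, ~~ (t i <= u <= t i + e)) -> 0 <= comb g u].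
  move=> e; have [/andP[e0 er]|_] := boolP (0 < e < r); last by exists 0.
  by have [g Pg] := nonneg_off_splits i0 e0 er tT sep cheb comb_continuous; exists g.
have near_er : \forall e \near 0^'+, 0 < e < r.
  by near=> e; apply/andP; split; near: e; [exact: nbhs_right_gt|exact: nbhs_right_lt].
pose F := G @ 0^'+.
have closedP (A : set R) v : closed A -> closed [set g | A (comb g v)].
  by apply: preimage_closed => g _; exact: comb_continuousl.
have sphere_compact : compact [set g : 'rV[R]_n | `|g| = 1].
  apply: bounded_closed_compact.
    by exists 1; split => // x x1 g /= ->; exact: ltW.
  apply: (@preimage_closed _ _ (fun g : 'rV[R]_n => `|g|) [set x | x = 1]).
    by move=> g _; exact: norm_continuous.
  exact: closed_eq.
have FF : ProperFilter F by exact: fmap_proper_filter.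
have [|g [/= g1]] := sphere_compact F FF.
  by apply: filterS near_er => e /GP[].
rewrite clusterE => gF.
have limP (A : set R) v : closed A -> (\forall e \near 0^'+, A (comb (G e) v)) ->
    A (comb g v).
  move=> /closedP cA FA; have /closure_id cAv : closed [set g | A (comb g v)] by exact: cA.
  by have := gF [set g | A (comb g v)] FA; rewrite -cAv.
exists g; split.
- by rewrite -normr_eq0 g1 oner_eq0.
- move=> i; apply: (limP [set x | x = 0]); first exact: closed_eq.
  by apply: filterS near_er => e /GP[_ /(_ i)].
- move=> u ru; have [[i ->]|ut] := pselect (exists i, u = t i).
    rewrite le_eqVlt; apply/orP; left; rewrite eq_sym; apply/eqP.
    apply: (limP [set x | x = 0]); first exact: closed_eq.
    by apply: filterS near_er => e /GP[_ /(_ i)].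
  apply: (limP [set x | 0 <= x]); first exact: closed_ge.
  near=> e; have [|_ _ Ge] := GP e; first by near: e.
  apply: Ge => // i; apply/negP => /andP[tu ute].
  have : forall z, z \in codom t -> u - e <= z <= u + e -> z = u.
    by near: e; exact: isolated_near.
  move=> /(_ (t i) (codom_f _ _)) tiu; apply: ut; exists i.
  by rewrite tiu//; apply/andP; split; lra.
Unshelve. all: by end_near. Qed.

(** Suppose that the nonnegative combination [g] vanishes at some [x] that is
    not a node.  Either [g] also vanishes near [t i] at a point other than
    [t i] (the node is flat), and there are two zeros already; or [t i] is an
    isolated zero at which [g] keeps its sign, and it splits in two under a
    perturbation [h] negative at [t i].  Choosing [h] zero at [x] and at the
    pairs of the flat nodes keeps the other zeros in place, so [g + d *: h] has
    [2M+1] zeros and must be [0]. *)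
Lemma positive_off_nodes r (i0 : 'I_M) : 0 < r ->
  (forall i, - T <= t i <= T) -> spaced r -> chebyshev_near r ->
  (forall h, continuous (comb h)) ->
  exists g, (forall i, comb g (t i) = 0) /\
    forall u, - T <= u <= T -> (forall i, u != t i) -> 0 < comb g u.
Proof.
move=> r0 tT sep cheb comb_continuous.
have [g [g0 gt gpos]] := double_zero_comb i0 r0 tT sep cheb comb_continuous.
exists g; split => // x xT xt; have rx : reach r x by left.
rewrite lt_neqAle gpos// andbT eq_sym; apply/negP => /eqP gx.
have /filter_ex[e [e0 er ex]] : \forall e \near 0^'+, [/\ 0 < e, e < r &
    forall z, z \in codom t -> x - e <= z <= x + e -> z = x].
  near=> e; split; [by near: e; exact: nbhs_right_gt|
    by near: e; exact: nbhs_right_lt|by near: e; exact: isolated_near].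
have {}ex i : t i + e < x \/ x < t i - e.
  have := xt i; have := ex (t i) (codom_f _ _).
  have [? _ _|xl tix /eqP xti] := ltP (t i + e) x; first by left.
  have [? |xr] := ltP x (t i - e); first by right.
  by exfalso; apply: xti; rewrite tix//; apply/andP; split; lra.
pose flat i := exists z, [/\ t i - e < z < t i + e, z != t i & comb g z = 0].
have /choice[p /choice[q pq]] : forall i, exists p, exists q,
    [/\ [/\ t i - e < p, p <= t i, t i <= q, q < t i + e & p < q],
      flat i -> comb g p = 0 /\ comb g q = 0 & ~ flat i -> p = t i].
  move=> i; have [/[dup] fi [z [/andP[zl zr] zt gz]]|nflat] := pselect (flat i).
    have [zti|tiz] := ltP z (t i).
      by exists z, (t i); split=> [|//|/(_ fi)//]; split; lra.
    have {}tiz : t i < z by rewrite lt_neqAle eq_sym zt.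
    by exists (t i), z; split=> [|//|/(_ fi)//]; split; lra.
  by exists (t i), (t i + e / 2); split=> [|/nflat//|//]; split; lra.
have strad p' q' : (forall i, [/\ t i - e < p' i, p' i <= t i, t i <= q' i,
    q' i < t i + e & p' i < q' i]) ->
    straddle r p' q' /\ forall i, x != p' i /\ x != q' i.
  move=> H; split=> i; have [h1 h2 h3 h4 h5] := H i; first by split; lra.
  by split; apply/eqP => xE; have := ex i; rewrite xE => -[]; lra.
have [strad_pq x_pq] : straddle r p q /\ forall i, x != p i /\ x != q i.
  by apply: strad => i; have [] := pq i.
have [guni /(_ (fun v =>
    if `[< exists i, v = t i /\ ~ flat i >] then -1 else 0))[h hy]] :=
  cheb _ _ _ strad_pq rx x_pq.
have hflat i v : flat i -> t i - e < v < t i + e -> node_set p q x v -> comb h v = 0.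
  move=> fi /andP[vl vr] Nv; rewrite hy//; case: asboolP => // -[j [vt]].
  have [<-//|/(spacedP sep)] := eqVneq i j.
  by rewrite -vt => -[]; lra.
have ht i : ~ flat i -> comb h (t i) = -1.
  move=> nfi; rewrite hy; last by right; exists i; left; have [_ _ ->] := pq i.
  by case: asboolP => // -[]; exists i.
have /filter_ex[d [d0 /choice[z1 /choice[z2 z12]]]] : \forall d \near 0^'+, 0 < d /\
    forall i, exists z1, exists z2,
    [/\ [/\ t i - e < z1, z1 <= t i, t i <= z2, z2 < t i + e & z1 < z2],
      comb (g + d *: h) z1 = 0 & comb (g + d *: h) z2 = 0].
  near=> d; split; first by near: d; exact: nbhs_right_gt.
  near: d; apply: filter_forall => i.
  have [[pl pt tq qr pq_i] pqflat _] := pq i.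
  have [fi|nfi] := pselect (flat i).
    near=> d; exists (p i), (q i); split; rewrite ?combDZ; first by split.
      rewrite (pqflat fi).1 (hflat i) ?mulr0 ?addr0//.
        by apply/andP; split; lra.
      by right; exists i; left.
    rewrite (pqflat fi).2 (hflat i) ?mulr0 ?addr0//.
      by apply/andP; split; lra.
    by right; exists i; right.
  have gnear v : t i - e < v < t i + e -> v != t i -> 0 < comb g v.
    move=> ve vt; rewrite lt_neqAle gpos ?andbT; last first.
      by apply: (@reach_near _ _ i); move: ve => /andP[? ?]; apply/andP; split; lra.
    by apply: contra_not_neq nfi => gv; exists v.
  have : \forall d \near 0^'+, exists z1 z2,
      [/\ t i - e / 2 < z1 < t i, t i < z2 < t i + e / 2,
      comb g z1 + d * comb h z1 = 0 & comb g z2 + d * comb h z2 = 0].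
    apply: perturb_roots => //; [lra|lra| | |by rewrite ht// ltrN10];
      by apply: gnear; [apply/andP; split; lra|apply/eqP; lra].
  apply: filterS => d [z1 [z2 [/andP[? ?] /andP[? ?] gz1 gz2]]].
  by exists z1, z2; rewrite !combDZ; split => //; split; lra.
have [strad_z x_z] : straddle r z1 z2 /\ forall i, x != z1 i /\ x != z2 i.
  by apply: strad => i; have [] := z12 i.
have hx : comb h x = 0.
  rewrite hy; last by left.
  by case: asboolP => // -[i [xti _]]; have := xt i; rewrite xti eqxx.
have [/(_ (g + d *: h)) w0 _] := cheb _ _ _ strad_z rx x_z.
have {}w0 : g + d *: h = 0.
  apply: w0 => v [->|[i [->|->]]]; last 2 first; try by have [] := z12 i.
  by rewrite combDZ gx hx mulr0 addr0.
(* Since [g] vanishes at [t i], [h] must too, which it only does when flat. *)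
have flat_all i : flat i.
  apply: contrapT => nfi; have : comb (g + d *: h) (t i) = 0 by rewrite w0 comb0.
  by rewrite combDZ gt ht//; lra.
move/eqP: g0; apply; apply: guni => v [->//|[i]].
by have [_ /(_ (flat_all i))[gp gq] _] := pq i; case=> ->.
Unshelve. all: by end_near. Qed.

Lemma delta_comb r j : 0 < r -> spaced r -> chebyshev_near r ->
  exists g, forall i, comb g (t i) = (i == j)%:R.
Proof.
move=> r0 sep cheb; have e0 : 0 < r / 2 by rewrite divr_gt0.
have er : r / 2 < r by lra.
have uZ := midpoint_not_split j e0 er sep.
have ru : reach r (t j + r / 2 / 2).
  by apply: (@reach_near _ _ j); apply/andP; split; lra.
have [_ /(_ (fun v => (v == t j)%:R))[g gy]] :=
  cheb _ _ _ (straddle_split e0 er) ru (not_split_nodes uZ).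
exists g => i; rewrite gy; last by right; exists i; left.
by rewrite (inj_eq (spaced_inj r0 sep)).
Qed.

End chebyshev_system.

(** * Integrals against finite measures *)

Section finite_integrals.
Context {R : realType}.
Implicit Types (mu : finmeas R) (X : seq R) (D : set (measurableTypeR R)).
Implicit Types (f : R -> R).

Lemma measurable_seq X : measurable ([set` X] : set (measurableTypeR R)).
Proof.
apply: countable_measurable; first by move=> y; exact: measurable_set1.
exact/finite_set_countable/finite_seq.
Qed.

Lemma integral_lincomb_indic mu D X f :
  measurable D -> uniq X -> (forall y, y \in X -> D y) ->
  (\int[mu]_(x in D) (\sum_(y <- X) f y * \1_[set y] x)%:E)%E =
  (\sum_(y <- X) f y * fine (mu [set y]))%:E.
Proof.
move=> mD uX XD; under eq_integral do rewrite -sumEFin.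
have mu1 y : (mu [set y] \is a fin_num)%E by rewrite fin_num_measure.
have int1 (y : R) : mu.-integrable D (EFin \o \1_[set y]).
  by apply: (integrableS measurableT) => //; exact: integrable_indic.
rewrite integral_sum//; last first.
  by move=> y; under eq_fun do rewrite EFinM; apply: integrableZl => //; exact: int1.
rewrite -sumEFin !big_seq; apply: eq_bigr => y yX.
under eq_integral do rewrite EFinM.
rewrite integralZl//; last exact: int1.
rewrite integral_indic// EFinM fineK//; congr (_ * mu _)%E.
by apply/setIidl => _ ->; exact: XD.
Qed.

Lemma lincomb_indicE X f x : uniq X -> x \in X ->
  \sum_(y <- X) f y * \1_[set y] x = f x.
Proof.
move=> uX xX; rewrite (bigD1_seq x)//= indicE mem_set// mulr1 big1 ?addr0//.
by move=> y yx; rewrite indicE memNset ?mulr0// => /= xy; rewrite xy eqxx in yx.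
Qed.

Lemma Rintegral_fset (P : finmeas R) (S : {fset R}) f :
  \int[P]_(s in [set` S]) f s = \sum_(s <- S) f s * fine (P [set s]).
Proof.
rewrite /Rintegral.
have mS : measurable ([set` S] : set (measurableTypeR R)).
  exact: (measurable_seq (enum_fset S)).
rewrite -[RHS]/(fine (_)%:E) -(@integral_lincomb_indic P [set` S] S f)//; last exact: fset_uniq.
congr fine; apply: eq_integral => s; rewrite inE /= => sS.
by rewrite lincomb_indicE ?fset_uniq.
Qed.

Lemma integral_finite_support mu X f :
  uniq X -> mu (~` [set` X]) = 0%E -> measurable_fun setT f ->
  (\int[mu]_x (f x)%:E)%E = (\sum_(y <- X) f y * fine (mu [set y]))%:E.
Proof.
move=> uX muX mf; rewrite -(@integral_lincomb_indic mu setT X f)//.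
apply: ae_eq_integral => //.
- exact/measurable_EFinP.
- apply/measurable_EFinP; apply: measurable_sum => y.
  by apply: measurable_funM => //; apply: measurable_indic; exact: measurable_set1.
- exists (~` [set` X]); split => //.
    by apply: measurableC; exact: measurable_seq.
  move=> x /= xX; apply: contra_not xX => xX _.
  by rewrite lincomb_indicE//; apply: contrapT.
Qed.

(** The integral is the difference of those of the positive and negative parts,
    and is infinite as soon as one of them is. *)
Lemma integrable_of_integral mu f (a : R) : measurable_fun setT f ->
  (\int[mu]_x (f x)%:E = a%:E)%E -> mu.-integrable setT (EFin \o f).
Proof.
move=> mf fa; apply/integrableP; split; first exact/measurable_EFinP.
by rewrite /= integral_fin_num_abs// fa.
Qed.

(** A point off the support has a null open neighbourhood, hence a null
    neighbourhood with rational end points, and there are countably many of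
    these. *)
Lemma negligible_setC_support mu : mu.-negligible (~` msupp mu).
Proof.
pose I (pq : rat * rat) : set (measurableTypeR R) :=
  `]ratr pq.1, ratr pq.2[%classic.
pose F k := if choice.unpickle k is Some pq then
  if mu (I pq) == 0%E then I pq else set0 else set0.
apply: (@negligibleS _ _ _ _ (\bigcup_k F k)); last first.
  apply: negligible_bigcup => k; rewrite /F.
  case: (choice.unpickle k) => [pq|]; last exact: negligible_set0.
  case: ifPn => [/eqP muI|_]; last exact: negligible_set0.
  by apply/negligibleP => //; exact: measurable_itv.
move=> u /=.
move=> /existsNP[U /not_implyP[oU /not_implyP[Uu /negP]]].
rewrite -leNgt measure_le0 => /eqP muU.
have [e /= e0 eU] := (nbhs_ballP _ _).1 (open_nbhs_nbhs (conj oU Uu)).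
have [p] := @rat_in_itvoo R (u - e) u ltac:(by rewrite gtrBl).
rewrite in_itv/= => /andP[ep pu].
have [q] := @rat_in_itvoo R u (u + e) ltac:(by rewrite ltrDl).
rewrite in_itv/= => /andP[uq qe].
exists (choice.pickle (p, q)); first by [].
have -> : F (choice.pickle (p, q)) =
    if mu (I (p, q)) == 0%E then I (p, q) else set0.
  by rewrite /F choice.pickleK.
have IU : I (p, q) `<=` U.
  move=> v; rewrite /I/= in_itv/= => /andP[pv vq]; apply: eU.
  by rewrite /ball/= ltr_norml; apply/andP; split; lra.
rewrite (_ : mu (I (p, q)) = 0%E); first by rewrite eqxx /I/= in_itv/= pu.
apply: (subset_measure0 _ _ IU muU); first exact: measurable_itv.
exact: open_measurable.
Qed.

Lemma null_setC_zeros mu X f : measurable_fun setT f ->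
  (forall u, msupp mu u -> u \notin X -> 0 < f u) ->
  (forall u, u \in X -> f u = 0) ->
  (\int[mu]_u (f u)%:E = 0)%E -> mu (~` [set` X]) = 0%E.
Proof.
move=> mf fpos fX intf.
have mEf : measurable_fun setT (EFin \o f) by exact/measurable_EFinP.
have suppf u : msupp mu u -> 0 <= f u.
  by move=> su; have [/fX ->//|/(fpos u su)/ltW] := boolP (u \in X).
have : ae_eq mu setT (EFin \o f) (cst 0%E).
  apply/ae_eq_integral_abs => //; rewrite -[RHS]intf; apply: ae_eq_integral => //.
    exact: measurableT_comp.
  apply: negligibleS (negligible_setC_support mu) => u /= nf su; apply: nf => _.
  by rewrite ger0_norm// suppf.
move=> f0; apply/negligibleP; first by apply: measurableC; exact: measurable_seq.
apply: negligibleS (negligibleU f0 (negligible_setC_support mu)) => u /= /negP uX.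
have [su|] := pselect (msupp mu u); last by right.
left => /(_ Logic.I) [fu]; by have := fpos u su uX; rewrite fu ltxx.
Qed.

End finite_integrals.

(** * From the determinantal condition to unique interpolation *)

Section model_system.
Context {R : realType} (S : {fset R}) (P : finmeas R) (psi : R -> R -> R) (T : R).
Context {M : nat} (t : 'I_M -> R).

(** Multiplying [kappa] by the weight gives a system that is defined and
    continuous everywhere, whether or not the weight vanishes. *)
Definition moments (u : R) : 'cV[R]_(M + M + 1) :=
  col_mx (\col_k \int[P]_(s in [set` S]) (psi s u * vvec psi t s k 0))
         (const_mx (weight S P psi u)).

(** This is what ties the combinations to the constraints, which concern the
    functions [psi s] for [s \in S] only. *)
Lemma moments_lincomb (g : 'rV[R]_(M + M + 1)) :
  exists a : R -> R, forall u, comb moments g u = \sum_(s <- S) a s * psi s u.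
Proof.
have coord k : exists b : R -> R, forall u,
    moments u k 0 = \sum_(s <- S) b s * psi s u.
  exists (fun s => fine (P [set s]) *
    (if fintype.split k is inl l then vvec psi t s l 0 else 1)) => u.
  rewrite mxE; case: (fintype.split k) => l; rewrite mxE /weight Rintegral_fset;
    by apply: eq_bigr => s _; ring.
have [b bE] := choice coord.
exists (fun s => \sum_k g 0 k * b k s) => u.
rewrite /comb mxE; under eq_bigr do rewrite bE mulr_sumr.
rewrite exchange_big/=; apply: eq_bigr => s _.
by rewrite mulr_suml; apply: eq_bigr => k _; rewrite mulrA.
Qed.

Lemma size_nodes (p q : 'I_M -> R) u : size (nodes p q u) = (M + M + 1)%N.
Proof.
rewrite /nodes size_rcons size_flatten /shape -map_comp addn1 sumnE big_map /=.
by rewrite big_const_seq count_predT iter_addn_0 size_enum_ord mul2n addnn.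
Qed.

Lemma mem_nodes (p q : 'I_M -> R) u v : v \in nodes p q u <-> node_set p q u v.
Proof.
rewrite /nodes mem_rcons inE; split.
  case/orP => [/eqP ->|/flatten_mapP[i _]]; first by left.
  by rewrite !inE => /orP[/eqP->|/eqP->]; right; exists i; [left|right].
case=> [->|[i iv]]; first by rewrite eqxx.
apply/orP; right; apply/flatten_mapP; exists i; first by rewrite mem_enum.
by rewrite !inE; case: iv => ->; rewrite eqxx ?orbT.
Qed.

Lemma nodes_uniq (p q : 'I_M -> R) r u : spaced t r ->
  (forall i, `|p i - t i| < r) -> (forall i, `|q i - t i| < r) ->
  (forall i, p i != q i) -> (forall i, u != p i /\ u != q i) ->
  uniq (nodes p q u).
Proof.
move=> sep pr qr pq upq.
have apart i j x y : i != j -> `|x - t i| < r -> `|y - t j| < r -> x != y.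
  move=> /(spacedP sep) ij; rewrite !ltr_norml => /andP[? ?] /andP[? ?].
  by apply/eqP => xy; case: ij => ?; lra.
rewrite /nodes rcons_uniq; apply/andP; split.
  apply/flatten_mapP => -[i _]; have [/negbTE up /negbTE uq] := upq i.
  by rewrite !inE up uq.
elim: (enum 'I_M) (enum_uniq 'I_M) => //= i s IH /andP[is_ /IH us].
rewrite us andbT; apply/andP; split.
  rewrite inE negb_or pq/=; apply/flatten_mapP => -[j js].
  have ij : i != j by apply: contraNneq is_ => ->.
  by rewrite !inE => /orP[/eqP|/eqP]; apply/eqP; exact: (apart i j).
apply/flatten_mapP => -[j js].
have ij : i != j by apply: contraNneq is_ => ->.
by rewrite !inE => /orP[/eqP|/eqP]; apply/eqP; exact: (apart i j).
Qed.

(** The matrix [Lambda] consists of the columns [moments v] divided by the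
    nonzero weights, so that [g *m Lambda] lists the values of the combination
    at the nodes up to nonzero factors. *)
Lemma unisolvent_Lambda (p q : 'I_M -> R) u : uniq (nodes p q u) ->
  (forall v, v \in nodes p q u -> weight S P psi v != 0) ->
  Lambda S P psi t (nodes p q u) \in unitmx ->
  unisolvent moments (node_set p q u).
Proof.
set N := nodes p q u; set L := Lambda _ _ _ _ _ => uN wN Lu.
have combE g (j : 'I_(M + M + 1)) :
    comb moments g N`_j = weight S P psi N`_j * (g *m L) 0 j.
  have Nj : N`_j \in N by rewrite mem_nth// size_nodes.
  rewrite /comb !mxE mulr_sumr; apply: eq_bigr => k _.
  rewrite mulrCA; congr (_ * _); rewrite !mxE.
  by case: (fintype.split k) => l; rewrite !mxE ?mulr1// mulVKf// wN.
have node_nth v : node_set p q u v -> exists j : 'I_(M + M + 1), v = N`_j.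
  move=> /mem_nodes vN; have jN : (index v N < M + M + 1)%N.
    by rewrite -(size_nodes p q u) index_mem.
  by exists (Ordinal jN); rewrite /= nth_index.
split=> [g g0|y].
  have gL0 : g *m L = 0.
    apply/rowP => j; rewrite [RHS]mxE.
    have Nj : N`_j \in N by rewrite mem_nth// size_nodes.
    have /eqP := combE g j; rewrite g0; last exact/mem_nodes.
    by rewrite eq_sym mulf_eq0 (negbTE (wN _ Nj)) => /eqP.
  by rewrite -(mulmxK Lu g) gL0 mul0mx.
exists ((\row_j (y N`_j / weight S P psi N`_j)) *m invmx L) => v /node_nth[j ->].
have Nj : N`_j \in N by rewrite mem_nth// size_nodes.
by rewrite combE mulmxKV// mxE mulrC divfK// wN.
Qed.

(** The determinantal condition demands the free point in [[-T, T]].  When [u]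
    is outside, it is close to a node [t i], and one of the two points that
    straddle [t i] is inside: exchanging the roles of [u] and of that point does
    not change the set of nodes. *)
Lemma determinantal_chebyshev : 0 < T -> (forall i, - T <= t i <= T) ->
  (forall i j : 'I_M, (i < j)%N -> t i < t j) ->
  determinantal S P psi T t ->
  exists r, [/\ 0 < r, spaced t r & chebyshev_near moments t T r].
Proof.
move=> T0 tT tmono [rho rho0 det].
have [r [r0 rrho rT sep]] : exists r, [/\ 0 < r, r <= rho, r <= T & spaced t r].
  have /filter_ex[r [r0 rr rT rs]] : \forall r \near 0^'+, [/\ 0 < r, r <= rho, r <= T &
      forall i j, i != j -> 2 * r <= `|t i - t j|].
    near=> r; split; [by near: r; exact: nbhs_right_gt|
      by near: r; exact: nbhs_right_le|by near: r; exact: nbhs_right_le|].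
    near: r; apply: filter_forall => i; apply: filter_forall => j.
    have [ij|ij] := eqVneq i j; first by near=> r.
    have tij : 0 < `|t i - t j|.
      rewrite normr_gt0 subr_eq0; have := ij; rewrite -val_eqE neq_ltn => /orP[|] /tmono.
        by move/lt_eqF/negbT.
      by move/gt_eqF/negbT.
    near=> r => _; rewrite mulrC -ler_pdivlMr//; near: r.
    by apply: nbhs_right_le; rewrite divr_gt0.
  by exists r.
exists r; split => // p q u strad ru upq.
have dist x i : t i - r < x < t i + r -> `|x - t i| < r.
  by move=> /andP[? ?]; rewrite ltr_norml; apply/andP; split; lra.
have inrho x i : `|x - t i| < r -> x \in `]t i - rho, t i + rho[.
  by rewrite ltr_norml in_itv/= => /andP[? ?]; apply/andP; split; lra.
have pr i : `|p i - t i| < r.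
  by have [? ? ? ? ?] := strad i; apply: dist; apply/andP; split; lra.
have qr i : `|q i - t i| < r.
  by have [? ? ? ? ?] := strad i; apply: dist; apply/andP; split; lra.
have pq i : p i != q i by have [_ _ _ _ ?] := strad i; apply/eqP; lra.
have unis (p' q' : 'I_M -> R) u' : (forall i, `|p' i - t i| < r) ->
    (forall i, `|q' i - t i| < r) -> (forall i, p' i != q' i) ->
    (forall i, u' != p' i /\ u' != q' i) -> - T <= u' <= T ->
    unisolvent moments (node_set p' q' u').
  move=> p'r q'r p'q' u'pq u'T.
  have uN := nodes_uniq sep p'r q'r p'q' u'pq.
  have [w L] := det p' q' u' (fun i => inrho _ _ (p'r i)) (fun i => inrho _ _ (q'r i))
    ltac:(by rewrite in_itv) uN.
  exact: unisolvent_Lambda.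
case: (ru) => [uT|[i ui]]; first exact: unis.
have apart j x y : j != i -> `|x - t i| < r -> `|y - t j| < r -> x != y.
  move=> /(spacedP sep) ij; rewrite !ltr_norml => /andP[? ?] /andP[? ?].
  by apply/eqP => xy; case: ij => ?; lra.
have [s1 s2 s3 s4 s5] := strad i; have /andP[tl tr] := tT i.
(* As [r <= T], the point on the side of [0] is within [[-T, T]]. *)
have [ti0|ti0] := leP 0 (t i).
  pose p' j := if j == i then u else p j.
  have -> : node_set p q u = node_set p' q (p i).
    rewrite /p'; apply/seteqP; split => v [->|[j]].
    - by right; exists i; left; rewrite eqxx.
    - have [->|ji] := eqVneq j i; first by case=> ->; [left|right; exists i; right].
      by case=> ->; right; exists j; rewrite (negbTE ji); [left|right].
    - by right; exists i; left.
    - case: (eqVneq j i) => [->|_]; first by case=> ->; [left|right; exists i; right].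
      by case=> ->; right; exists j; [left|right].
  apply: unis => //; rewrite /p'.
  - by move=> j; case: (eqVneq j i) => [->|_].
  - by move=> j; case: (eqVneq j i) => [->|_]//; exact: (upq i).2.
  - move=> j; case: (eqVneq j i) => [->|ji]; split => //.
    + by rewrite eq_sym; exact: (upq i).1.
    + exact: (apart j).
    + exact: (apart j).
  - by apply/andP; split; lra.
pose q' j := if j == i then u else q j.
have -> : node_set p q u = node_set p q' (q i).
  rewrite /q'; apply/seteqP; split => v [->|[j]].
  - by right; exists i; right; rewrite eqxx.
  - have [->|ji] := eqVneq j i; first by case=> ->; [right; exists i; left|left].
    by case=> ->; right; exists j; rewrite (negbTE ji); [left|right].
  - by right; exists i; right.
  - case: (eqVneq j i) => [->|_]; first by case=> ->; [right; exists i; left|left].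
    by case=> ->; right; exists j; [left|right].
apply: unis => //; rewrite /q'.
- by move=> j; case: (eqVneq j i) => [->|_].
- by move=> j; case: (eqVneq j i) => [->|_]//; rewrite eq_sym; exact: (upq i).1.
- move=> j; case: (eqVneq j i) => [->|ji]; split => //.
  + by rewrite eq_sym.
  + by rewrite eq_sym; exact: (upq i).2.
  + exact: (apart j).
  + exact: (apart j).
- by apply/andP; split; lra.
Unshelve. all: by end_near. Qed.

Lemma comb_moments_continuous : (forall s, continuous (psi s)) ->
  forall g, continuous (comb moments g).
Proof.
move=> cpsi g; have [a aE] := moments_lincomb g.
rewrite (_ : comb moments g = fun u => \sum_(s <- S) a s * psi s u); last exact/funext.
apply: continuous_big; first exact: add_continuous.
move=> s _ u; apply: (@continuousM R _ (cst (a s)) (psi s)); last exact: cpsi.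
exact: cst_continuous.
Qed.

Lemma integral_comb_moments (x : R -> R) (mu : finmeas R) g :
  (forall s, continuous (psi s)) ->
  (forall s, s \in S -> (\int[mu]_u (psi s u)%:E = (x s)%:E)%E) ->
  forall a, (forall u, comb moments g u = \sum_(s <- S) a s * psi s u) ->
  (\int[mu]_u (comb moments g u)%:E = (\sum_(s <- S) a s * x s)%:E)%E.
Proof.
move=> cpsi mux a aE.
have int_psi s : s \in S -> mu.-integrable setT (EFin \o psi s).
  move=> sS; apply: integrable_of_integral (mux s sS).
  exact: continuous_measurable_fun.
pose h s u := if s \in S then ((a s)%:E * (psi s u)%:E)%E else 0%E.
have int_h s : mu.-integrable setT (h s).
  have [sS|/negbTE sS] := boolP (s \in S); rewrite /h sS; last exact: integrable0.
  by apply: integrableZl => //; exact: int_psi.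
transitivity (\int[mu]_u (\sum_(s <- S) h s u))%E.
  apply: eq_integral => u _; rewrite aE -sumEFin; apply: eq_big_seq => s sS.
  by rewrite /h sS EFinM.
rewrite (integral_sum measurableT int_h).
rewrite -sumEFin; apply: eq_big_seq => s sS; rewrite /h sS.
by rewrite integralZl//; [rewrite mux|exact: int_psi].
Qed.

Lemma integral_comb_feasible (c : 'I_M -> {posnum R}) (mu : finmeas R) g :
  (forall s, continuous (psi s)) -> feasible S psi T (signal t c psi) mu ->
  (\int[mu]_u (comb moments g u)%:E =
   (\sum_i (c i)%:num * comb moments g (t i))%:E)%E.
Proof.
move=> cpsi [_ mux]; have [a aE] := moments_lincomb g.
rewrite (integral_comb_moments cpsi mux aE); congr EFin; rewrite /signal.
under eq_bigr do rewrite mulr_sumr.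
rewrite exchange_big/=; apply: eq_bigr => i _.
by rewrite aE mulr_sumr; apply: eq_bigr => s _; rewrite mulrCA.
Qed.

End model_system.

(** * Uniqueness of the feasible measure *)

Section atomic_measure.
Context {R : realType} {M : nat} (t : 'I_M -> R) (c : 'I_M -> {posnum R}).

Lemma mu_starE (A : set (measurableTypeR R)) :
  mu_star t c A = (\sum_i (c i)%:num * \1_A (t i))%:E.
Proof. by rewrite /mu_star -sumEFin; apply: eq_bigr => i _; rewrite diracE EFinM. Qed.

Lemma integral_on_nodes (mu : finmeas R) f : injective t ->
  mu (~` [set` codom t]) = 0%E -> measurable_fun setT f ->
  (\int[mu]_x (f x)%:E)%E = (\sum_i f (t i) * fine (mu [set t i]))%:E.
Proof.
move=> t_inj mut mf; rewrite (integral_finite_support _ mut mf); last exact/injectiveP.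
by rewrite big_map big_enum.
Qed.

Lemma mu_star_setC_nodes : mu_star t c (~` [set` codom t]) = 0%E.
Proof.
rewrite mu_starE big1// => i _.
by rewrite indicE memNset ?mulr0//= => /(_ (codom_f t i)).
Qed.

Lemma fine_mu_star1 i : injective t ->
  fine (mu_star t c [set t i]) = (c i)%:num.
Proof.
move=> t_inj; rewrite mu_starE/= (bigD1 i)//= indicE mem_set// mulr1 big1 ?addr0// => j ji.
by rewrite indicE memNset ?mulr0//= => /t_inj; apply/eqP.
Qed.

Lemma feasible_mu_star (S : {fset R}) (psi : R -> R -> R) (T : R) :
  injective t -> (forall s, continuous (psi s)) ->
  (forall i, - T <= t i <= T) ->
  feasible S psi T (signal t c psi) (mu_star t c).
Proof.
move=> t_inj cpsi tT; split=> [u su|s _].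
  rewrite /= in_itv/=; apply: contrapT => /negP uT.
  have oU : open (~` `[- T, T] : set R) by apply: closed_openC; exact: interval_closed.
  have := su _ oU; rewrite /= in_itv/= => /(_ (negP uT)).
  rewrite mu_starE big1 ?ltxx// => i _.
  by rewrite indicE memNset ?mulr0//= => /(_ _); rewrite in_itv/= => -[]; exact: tT.
rewrite (integral_on_nodes t_inj mu_star_setC_nodes); last exact: continuous_measurable_fun.
congr EFin; apply: eq_bigr => i _.
by rewrite [X in _ * X]fine_mu_star1// mulrC.
Qed.

End atomic_measure.

(** Integrating the combination of [positive_off_nodes] shows that [mu] is
    carried by the nodes, and integrating those of [delta_comb] shows that it
    has the same masses there as [mu_star]. *)
Lemma feasible_unique (R : realType) (M : nat) (T : R) (t : 'I_M -> R)
    (c : 'I_M -> {posnum R}) (S : {fset R}) (P : finmeas R)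
    (psi : R -> R -> R) (mu : finmeas R) :
  (1 <= M)%N -> 0 < T ->
  (forall i j : 'I_M, (i < j)%N -> t i < t j) ->
  (forall i, - T <= t i <= T) ->
  (forall s, continuous (psi s)) ->
  determinantal S P psi T t ->
  feasible S psi T (signal t c psi) mu ->
  forall A : set (measurableTypeR R), measurable A -> mu A = mu_star t c A.
Proof.
move=> M1 T0 tmono tT cpsi det fmu A mA.
have [r [r0 sep cheb]] := determinantal_chebyshev T0 tT tmono det.
have t_inj := spaced_inj r0 sep.
have ccomb := comb_moments_continuous (P := P) (S := S) (t := t) cpsi.
have [g [gt gpos]] := positive_off_nodes (Ordinal M1) r0 tT sep cheb ccomb.
have mut : mu (~` [set` codom t]) = 0%E.
  apply: (@null_setC_zeros R mu (codom t) (comb (moments S P psi t) g)).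
  - exact: continuous_measurable_fun.
  - move=> u /fmu.1 /=; rewrite in_itv/= => uT ut; apply: gpos => // i.
    by apply: contraNneq ut => ->; exact: codom_f.
  - by move=> _ /codomP[i ->].
  - by rewrite (integral_comb_feasible P g cpsi fmu) big1// => i _; rewrite gt mulr0.
have mass j : fine (mu [set t j]) = (c j)%:num.
  have [h ht] := delta_comb j r0 sep cheb.
  have := integral_comb_feasible P h cpsi fmu.
  rewrite (integral_on_nodes t_inj mut); last exact: continuous_measurable_fun.
  move=> /(congr1 fine)/=.
  rewrite (bigD1 j)//= ht eqxx mul1r big1 ?addr0; last first.
    by move=> i ij; rewrite ht (negbTE ij) mul0r.
  rewrite (bigD1 j)//= ht eqxx mulr1 big1 ?addr0// => i ij.
  by rewrite ht (negbTE ij) mulr0.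
rewrite mu_starE -[in LHS](setIT A) -integral_indic//.
rewrite (integral_on_nodes t_inj mut); last exact: measurable_indic.
by congr EFin; apply: eq_bigr => i _; rewrite mass mulrC.
Qed.

Theorem theorem1p2 (R : realType) (M : nat) (T : R) (t : 'I_M -> R)
    (c : 'I_M -> {posnum R}) (S : {fset R}) (P : finmeas R)
    (psi : R -> R -> R) :
  (1 <= M)%N -> 0 < T ->
  (forall i j : 'I_M, (i < j)%N -> t i < t j) ->
  (forall i : 'I_M, t i \in `[- T, T]) ->
  carried_by S P ->
  (forall s u : R, derivable (psi s) u 1) ->
  integrability S P psi ->
  positivity S P psi T ->
  independence S P psi t ->
  determinantal S P psi T t ->
  (2 * M < #|` S|)%N ->
  optimal S P psi T (signal t c psi) (mu_star t c) /\
  forall mu : finmeas R,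
    optimal S P psi T (signal t c psi) mu ->
    forall A : set (measurableTypeR R), measurable A -> mu A = mu_star t c A.
Proof.
move=> M1 T0 tmono tT _ dpsi _ _ _ det _.
have {}tT i : - T <= t i <= T by have := tT i; rewrite in_itv.
have cpsi s : continuous (psi s).
  by move=> u; apply: differentiable_continuous; exact/derivable1_diffP.
have unique mu : feasible S psi T (signal t c psi) mu ->
    forall A : set (measurableTypeR R), measurable A -> mu A = mu_star t c A.
  exact: (feasible_unique M1 T0 tmono tT cpsi det).
have t_inj : injective t.
  move=> i j tij; apply/eqP/negPn/negP; rewrite -val_eqE neq_ltn.
  by case/orP => /tmono; rewrite tij ltxx.
split; last by move=> mu [fmu _]; exact: unique.
split; first exact: feasible_mu_star.
move=> nu fnu; rewrite /objective (@eq_measure_integral _ _ _ setT nu)// => A mA _.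
by symmetry; apply: unique.
Qed.
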